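(* Let $\{\lambda_k\}_{k\in\mathbb N}$ be a sequence of positive numbers. Every point of the phase space $E$ is a nonwandering point of the flow of the Hamiltonian system with Hamilton function $H(q,p)=\sum_{k=1}^{\infty}\frac{\lambda_k}{2}(p_k^2+q_k^2)$.
   Context: The phase space is the real Hilbert space $E=Q\oplus P$ with $Q=P=\ell_2(\mathbb N,\mathbb R)$, identified with the complex space $\ell_2=\ell_2(\mathbb N,\mathbb C)$ by $z_k=q_k+ip_k$. The flow of the Hamiltonian system is the group $\mathbf V_t$, $t\in\mathbb R$, on $E$ given by $(\mathbf V_t z)_k=e^{i\lambda_k t}z_k$, $k\in\mathbb N$. A point $A$ is nonwandering with respect to the flow $\mathbf V_t$, $t\ge 0$, if for any neighborhood $O(A)$ of $A$ and any number $T>0$ there is a number $t>T$ such that $O(A)\cap\mathbf V_t(O(A))\neq\emptyset$. *)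

(* Defs.v *)
From HB Require Import structures.
From mathcomp Require Import all_boot all_order all_algebra.
From mathcomp Require Import all_classical all_reals all_analysis.
From mathcomp Require Import complex ring.

Set Implicit Arguments.
Unset Strict Implicit.
Unset Printing Implicit Defensive.

Import Order.TTheory GRing.Theory Num.Theory.
Import numFieldNormedType.Exports.

Local Open Scope classical_set_scope.
Local Open Scope ring_scope.

Section SquareSummable.
Variable R : realType.
Implicit Types w : Rcomplex R.

Lemma normRcE w : `|w| ^+ 2 = complex.Re w ^+ 2 + complex.Im w ^+ 2.
Proof.
case: w => a b; rewrite /Num.norm/= sqr_sqrtr//.
by rewrite addr_ge0// sqr_ge0.
Qed.

Lemma normRcZ (a : R) w : `|a *: w| = `|a| * `|w|.
Proof.
apply/eqP; rewrite -(@eqrXn2 _ 2)// ?mulr_ge0//; apply/eqP.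
rewrite exprMn !normRcE real_normK ?num_real//.
by case: w => b c /=; rewrite !exprMn mulrDr.
Qed.

Lemma normRcM w1 w2 : `|(w1 * w2 : Rcomplex R)| = `|w1| * `|w2|.
Proof. exact: ComplexField.Normc.normcM. Qed.

Definition square_summable : {pred nat -> Rcomplex R} :=
  [pred z : nat -> Rcomplex R | `[< cvgn (series (fun k => `|z k| ^+ 2)) >]].

Lemma square_summableP (z : nat -> Rcomplex R) :
  reflect (cvgn (series (fun k => `|z k| ^+ 2))) (z \in square_summable).
Proof. by rewrite inE; exact: asboolP. Qed.

Lemma square_summable_submod : submod_closed square_summable.
Proof.
split.
  apply/square_summableP.
  rewrite (_ : series _ = cst 0); first exact: is_cvg_cst.
  by apply/funext => n; rewrite /series/= big1// => k _; rewrite normr0 expr0n.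
move=> a x y /square_summableP cx /square_summableP cy.
apply/square_summableP.
apply: (@series_le_cvg _ _ ((2 * `|a| ^+ 2) *: (fun k => `|x k| ^+ 2) +
                   (2 : R) *: (fun k => `|y k| ^+ 2))).
- by move=> k; exact: sqr_ge0.
- move=> k; rewrite /GRing.add/= /GRing.scale/=.
  by rewrite addr_ge0// !mulr_ge0// sqr_ge0.
- move=> k; rewrite -[leRHS]/(2 * `|a| ^+ 2 * `|x k| ^+ 2 + 2 * `|y k| ^+ 2).
  rewrite -[leLHS]/(`|a *: x k + y k| ^+ 2) -mulrA -exprMn -normRcZ.
  have := ler_normD (a *: x k) (y k).
  set u := `|a *: x k|; set v := `|y k|.
  have u0 : 0 <= u := normr_ge0 _. have v0 : 0 <= v := normr_ge0 _.
  move=> h; have := @lerXn2r R 2 _ _ (normr_ge0 _) (addr_ge0 u0 v0) h.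
  move=> /le_trans; apply.
  rewrite -subr_ge0 (_ : _ - _ = (u - v) ^+ 2) ?sqr_ge0//.
  by ring.
- by apply: is_cvg_seriesD; exact: is_cvg_seriesZ.
Qed.

HB.instance Definition _ := GRing.isSubmodClosed.Build R (nat -> Rcomplex R)
  square_summable square_summable_submod.

End SquareSummable.

(* [Rcomplex R] is the complex field seen as a normed space over R, so [ell2 R]
   is a real vector space. Its element z stands for the pair (q, p) of real
   square-summable sequences with z_k = q_k + i p_k, and since
   |z_k|^2 = q_k^2 + p_k^2 (normRcE) its norm is the Hilbert norm of the
   orthogonal sum of the two real spaces. Sequences are indexed from 0. *)
Record ell2 (R : realType) := Ell2 {
  ell2_val :> nat -> Rcomplex R ;
  ell2_valP : ell2_val \in @square_summable R }.

HB.instance Definition _ (R : realType) := [isSub for @ell2_val R].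
HB.instance Definition _ (R : realType) := [Choice of ell2 R by <:].
HB.instance Definition _ (R : realType) := [SubChoice_isSubLmodule of ell2 R by <:].

Section Ell2Norm.
Variable R : realType.
Implicit Types x y z : ell2 R.

Lemma ell2_cvg z : cvgn (series (fun k => `|z k| ^+ 2)).
Proof. exact/square_summableP/ell2_valP. Qed.

Lemma ell2P x y : (forall k, x k = y k) -> x = y.
Proof. by move=> xy; apply/val_inj/funext. Qed.

Definition ell2_norm z : R := Num.sqrt (limn (series (fun k => `|z k| ^+ 2))).

Lemma ell2_lim_ge z n : series (fun k => `|z k| ^+ 2) n <=
  limn (series (fun k => `|z k| ^+ 2)).
Proof.
apply: nondecreasing_cvgn_le; last exact: ell2_cvg.
by apply: nondecreasing_series => k _ _; exact: sqr_ge0.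
Qed.

Lemma ell2_lim_ge0 z : 0 <= limn (series (fun k => `|z k| ^+ 2)).
Proof. by have := ell2_lim_ge z 0; rewrite /series/= big_geq. Qed.

Lemma ell2_norm_sqr z : ell2_norm z ^+ 2 = limn (series (fun k => `|z k| ^+ 2)).
Proof. by rewrite sqr_sqrtr// ell2_lim_ge0. Qed.

Lemma ell2_norm_ge0 z : 0 <= ell2_norm z. Proof. exact: sqrtr_ge0. Qed.

Lemma ell2_normr0_eq0 z : ell2_norm z = 0 -> z = 0.
Proof.
move=> z0; apply: ell2P => k.
have := ell2_lim_ge z k.+1; rewrite -ell2_norm_sqr z0 expr0n/= => h.
have : `|z k| ^+ 2 <= 0.
  apply: le_trans h; rewrite /series/= big_nat_recr//= lerDr.
  by apply: sumr_ge0 => i _; exact: sqr_ge0.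
move=> zk0; apply/eqP; rewrite -normr_eq0 -sqrf_eq0 eq_le.
by apply/andP; split; [exact: zk0|exact: sqr_ge0].
Qed.

Lemma ell2_normZ (a : R) z : ell2_norm (a *: z) = `|a| * ell2_norm z.
Proof.
rewrite /ell2_norm.
rewrite (_ : (fun k => _) = (`|a| ^+ 2) *: (fun k => `|z k| ^+ 2) :> R^nat).
  rewrite lim_seriesZ; last exact: ell2_cvg.
  by rewrite sqrtrM ?sqr_ge0// sqrtr_sqr normr_id.
apply/funext => k; rewrite -[RHS]/(`|a| ^+ 2 * `|z k| ^+ 2) -exprMn -normRcZ.
by [].
Qed.

Lemma ler_ell2_normD x y : ell2_norm (x + y) <= ell2_norm x + ell2_norm y.
Proof.
have [->|x0] := eqVneq x 0.
  by rewrite add0r lerDr ell2_norm_ge0.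
have [->|y0] := eqVneq y 0.
  by rewrite addr0 lerDl ell2_norm_ge0.
have pos z : z != 0 -> 0 < ell2_norm z.
  move=> z0; rewrite lt_def ell2_norm_ge0 andbT.
  by apply: contra z0 => /eqP/ell2_normr0_eq0 ->.
have {x0} := pos _ x0; have {y0} := pos _ y0.
have := ell2_norm_sqr x; have := ell2_norm_sqr y.
set a := ell2_norm x; set b := ell2_norm y => hb ha b0 a0.
rewrite -(@ler_pXn2r _ 2) ?nnegrE ?addr_ge0 ?ell2_norm_ge0//.
rewrite ell2_norm_sqr.
pose f := (1 + b / a) *: (fun k => `|x k| ^+ 2 : R) : R^nat.
pose g := (1 + a / b) *: (fun k => `|y k| ^+ 2 : R) : R^nat.
have cf : cvgn (series f) by apply: is_cvg_seriesZ; exact: ell2_cvg.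
have cg : cvgn (series g) by apply: is_cvg_seriesZ; exact: ell2_cvg.
apply: (@le_trans _ _ (limn (series (f + g)))).
  apply: lim_series_le; [exact: ell2_cvg|exact: is_cvg_seriesD|].
  move=> k.
  rewrite -[leRHS]/((1 + b / a) * `|x k| ^+ 2 + (1 + a / b) * `|y k| ^+ 2).
  have := ler_normD (x k) (y k).
  set u := `|x k|; set v := `|y k|.
  have u0 : 0 <= u := normr_ge0 _. have v0 : 0 <= v := normr_ge0 _.
  move=> h; have := @lerXn2r R 2 _ _ (normr_ge0 _) (addr_ge0 u0 v0) h.
  move=> /le_trans; apply.
  rewrite -subr_ge0.
  have -> : (1 + b / a) * u ^+ 2 + (1 + a / b) * v ^+ 2 - (u + v) ^+ 2 =
            (b * u - a * v) ^+ 2 / (a * b).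
    by field; rewrite !gt_eqF.
  by rewrite divr_ge0 ?sqr_ge0// mulr_ge0// ltW.
rewrite lim_seriesD// lim_seriesZ ?lim_seriesZ; [|exact: ell2_cvg..].
rewrite -ha -hb.
rewrite le_eqVlt; apply/orP; left; apply/eqP.
rewrite /GRing.scale/=.
by field; rewrite !gt_eqF.
Qed.

HB.instance Definition _ := Lmodule_isNormed.Build R (ell2 R)
  ler_ell2_normD ell2_normZ ell2_normr0_eq0.

End Ell2Norm.

Section Flow.
Variable R : realType.
Implicit Types (z : ell2 R) (lam : nat -> R).

Definition position z (k : nat) : R := complex.Re (z k).
Definition momentum z (k : nat) : R := complex.Im (z k).

Definition expi (x : R) : Rcomplex R := Complex (cos x) (sin x).

Lemma normr_expi x : `|expi x| = 1.
Proof.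
apply/eqP; rewrite -(@eqrXn2 _ 2)//; apply/eqP.
by rewrite normRcE/= cos2Dsin2 expr1n.
Qed.

Lemma expiD x y : expi (x + y) = expi x * expi y.
Proof. by rewrite /expi cosD sinD; congr Complex; rewrite addrC. Qed.

Lemma expi0 : expi 0 = 1. Proof. by rewrite /expi cos0 sin0. Qed.

Lemma rotation_subproof lam (t : R) z :
  (fun k => expi (lam k * t) * z k) \in @square_summable R.
Proof.
apply/square_summableP; have := @ell2_cvg R z.
suff <- : (fun k => `|(expi (lam k * t) * z k : Rcomplex R)| ^+ 2) =
         (fun k => `|z k| ^+ 2) by [].
by apply/funext => k; rewrite normRcM normr_expi mul1r.
Qed.

Definition oscillator_flow lam (t : R) z : ell2 R :=
  Ell2 (@rotation_subproof lam t z).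

Lemma oscillator_flow0 lam z : oscillator_flow lam 0 z = z.
Proof. by apply: ell2P => k /=; rewrite mulr0 expi0 mul1r. Qed.

Lemma oscillator_flowD lam s t z :
  oscillator_flow lam (s + t) z = oscillator_flow lam s (oscillator_flow lam t z).
Proof. by apply: ell2P => k /=; rewrite mulrDr expiD mulrA. Qed.

(* Infinite where the series diverges, which can happen when lam is unbounded. *)
Definition oscillator_hamiltonian lam z : \bar R :=
  (\sum_(0 <= k <oo)
     (lam k / 2 * (momentum z k ^+ 2 + position z k ^+ 2))%:E)%E.

Lemma single_subproof (k : nat) (w : Rcomplex R) :
  (fun j => if j == k then w else 0) \in @square_summable R.
Proof.
apply/square_summableP; apply: (@nnseries_is_cvg R).
  by move=> i; exact: sqr_ge0.
rewrite (@nneseriesD1 _ _ k)//.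
rewrite [X in (_ + X)%E]eseries0 ?adde0 ?ltry// => i _ /=.
by move/negPf => ->; rewrite normr0 expr0n.
Qed.

Definition single k w : ell2 R := Ell2 (@single_subproof k w).
Definition position_dir k := single k 1.
Definition momentum_dir k := single k (Complex 0 1).

Local Notation H := oscillator_hamiltonian.

Lemma oscillator_hamiltonian_flow lam t z : H lam (oscillator_flow lam t z) = H lam z.
Proof.
apply: eq_eseriesr => k _; congr (_%:E); congr (_ * _).
rewrite addrC [RHS]addrC /position /momentum -!normRcE/=.
by rewrite normRcM normr_expi mul1r.
Qed.

Lemma is_derive_hamiltonian lam z k (a b : R) : (forall j, 0 < lam j) ->
  (H lam z < +oo)%E ->
  is_derive z (single k (Complex a b)) (fine \o H lam)
    (lam k * (a * position z k + b * momentum z k)).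
Proof.
move=> lam0 Hz.
have term0 x j : (0 <= (lam j / 2 * (momentum x j ^+ 2 + position x j ^+ 2))%:E)%E.
  rewrite lee_fin; apply: mulr_ge0; first by apply: divr_ge0 => //; exact: ltW.
  by apply: addr_ge0; exact: sqr_ge0.
pose rest : \bar R := (\sum_(0 <= j <oo | j != k)
     (lam j / 2 * (momentum z j ^+ 2 + position z j ^+ 2))%:E)%E.
have HE (x : ell2 R) : (forall j, j != k -> x j = z j) ->
    (H lam x = (lam k / 2 * (momentum x k ^+ 2 + position x k ^+ 2))%:E + rest)%E.
  move=> xz; rewrite /H (@nneseriesD1 _ _ k)//; congr (_ + _)%E.
  by apply: eq_eseriesr => j jk; rewrite /momentum /position xz.
have rest_fin : rest \is a fin_num.
  rewrite ge0_fin_numE; last by apply: nneseries_ge0.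
  apply: le_lt_trans Hz; rewrite (HE z)//.
  by rewrite leeDr.
have fineH (x : ell2 R) : (forall j, j != k -> x j = z j) -> fine (H lam x) =
    lam k / 2 * (momentum x k ^+ 2 + position x k ^+ 2) + fine rest.
  by move=> xz; rewrite (HE _ xz) fineD.
set v := single _ _.
pose c := lam k * (a * position z k + b * momentum z k).
have line h : (forall j, j != k -> (h *: v + z) j = z j) /\
    (h *: v + z) k = h *: (Complex a b : Rcomplex R) + z k.
  split=> [j /negPf jk|].
    rewrite -[LHS]/(h *: (if j == k then Complex a b : Rcomplex R else 0) + z j).
    by rewrite jk scaler0 add0r.
  rewrite -[LHS]/(h *: (if k == k then Complex a b : Rcomplex R else 0) + z k).
  by rewrite eqxx.
have quot : {near (0 : R)^', (fun h => c + lam k / 2 * (a ^+ 2 + b ^+ 2) * h) =1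
    (fun h => h^-1 *: ((fine \o H lam) (h *: v + z) - (fine \o H lam) z))}.
  near=> h; have h0 : h != 0 by near: h; exact: nbhs_dnbhs_neq.
  have [hj hk] := line h.
  rewrite /= (fineH _ hj) (fineH z)// /c /momentum /position hk.
  case: (z k) => x y /=; rewrite /GRing.scale/=.
  by field.
have cv : (fun h => h^-1 *: ((fine \o H lam) (h *: v + z) -
      (fine \o H lam) z)) @ (0 : R)^' --> c.
  pose d := lam k / 2 * (a ^+ 2 + b ^+ 2).
  have : (fun h => c + d * h) @ (0 : R)^' --> c + d * 0.
    apply: cvgD; first exact: cvg_cst.
    apply: cvgM; first exact: cvg_cst.
    exact: nbhs_dnbhs.
  rewrite mulr0 addr0; apply: cvg_trans.
  exact: near_eq_cvg quot.
by apply: DeriveDef; [exact: cvgP cv|exact: cvg_lim cv].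
Unshelve. all: by end_near. Qed.

(* With the sign e^{+ i lam_k t}, [oscillator_flow] solves Hamilton's equations
   in the orientation dq_k/dt = - dH/dp_k, dp_k/dt = dH/dq_k; the opposite
   orientation corresponds to reversing time. *)
Lemma oscillator_flow_hamilton lam z (k : nat) (t : R) : (forall j, 0 < lam j) ->
  (H lam z < +oo)%E ->
  is_derive t (1 : R) (fun s => position (oscillator_flow lam s z) k)
    (- 'D_(momentum_dir k) (fine \o H lam) (oscillator_flow lam t z)) /\
  is_derive t (1 : R) (fun s => momentum (oscillator_flow lam s z) k)
    ('D_(position_dir k) (fine \o H lam) (oscillator_flow lam t z)).
Proof.
move=> lam0 Hz.
have Hz' : (H lam (oscillator_flow lam t z) < +oo)%E.
  by rewrite oscillator_hamiltonian_flow.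
have [_ Dp] := is_derive_hamiltonian k 0 1 lam0 Hz'.
have [_ Dq] := is_derive_hamiltonian k 1 0 lam0 Hz'.
rewrite /momentum_dir /position_dir Dp Dq /position /momentum/=.
have dlin : is_derive t (1 : R) (fun s => lam k * s) (lam k).
  by apply: is_derive_eq; rewrite /GRing.scale/= mulr1.
have dcos : is_derive t (1 : R) (fun s => cos (lam k * s))
    (- sin (lam k * t) * lam k).
  exact: (@is_derive1_comp _ cos (fun s => lam k * s)).
have dsin : is_derive t (1 : R) (fun s => sin (lam k * s))
    (cos (lam k * t) * lam k).
  exact: (@is_derive1_comp _ sin (fun s => lam k * s)).
case: (z k) => x y /=; split.
  apply: is_derive_eq; rewrite /GRing.scale/=; ring.
apply: is_derive_eq; rewrite /GRing.scale/=; ring.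
Qed.

End Flow.

Definition nonwandering (R : realType) (X : topologicalType) (V : R -> X -> X)
    (A : X) : Prop :=
  forall O : set X, nbhs A O -> forall T : R, 0 < T ->
    exists2 t : R, T < t & O `&` (V t @` O) !=set0.

(* Main.v *)
Require Import Defs.
From mathcomp Require Import all_boot all_order all_algebra.
From mathcomp Require Import all_classical all_reals all_analysis.
From mathcomp Require Import complex ring lra.

(* The orbit of A is totally bounded: the coordinates of large index contribute
   little, uniformly in time, and the remaining finitely many move in a bounded
   set. So among the points V_{ns} A, n = 0, 1, ..., two are close, say for
   m < n, and since the flow is isometric V_{(n-m)s} A is close to A. *)

Import Order.TTheory GRing.Theory Num.Theory.
Import numFieldNormedType.Exports.
Local Open Scope ring_scope.

(** Shifting, dividing by [e] and truncating sorts the points of the cube into finitely many boxes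
    of side [e]; among [K.+1] points two share a box. *)
Lemma bounded_pigeonhole (R : realType) (I : finType) (f : nat -> I -> R) (e : R) :
  (forall n i, `|f n i| <= 1) -> 0 < e ->
  exists m n, (m < n)%N /\ forall i, `|f n i - f m i| < e.
Proof.
move=> f1 e0; pose g n i := (f n i + 1) / e.
have g_itv n i : 0 <= g n i <= 2 / e.
  have := f1 n i; rewrite ler_norml => /andP[fl fr].
  rewrite divr_ge0 ?(ltW e0)//=; last by lra.
  by rewrite ler_pM2r ?invr_gt0//; lra.
pose M := Num.truncn (2 / e).
have g_lt n i : (Num.truncn (g n i) < M.+1)%N.
  by rewrite ltnS; apply: le_truncn; have /andP[] := g_itv n i.
pose box n := [ffun i => Ordinal (g_lt n i)].
pose K := #|{ffun I -> 'I_M.+1}|.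
have : ~~ injectiveb (fun n : 'I_K.+1 => box n).
  apply/negP => /injectiveP /leq_card.
  by rewrite card_ord ltnn.
move=> /injectivePn[m [n mn boxE]].
wlog lt_mn : m n mn boxE / (m < n)%N.
  move=> wl; have [|ge_nm] := ltnP m n; first exact: wl.
  apply: (wl n m); rewrite 1?eq_sym// ltn_neqAle ge_nm andbT eq_sym.
  exact: mn.
exists m, n; split=> // i.
have /ffunP/(_ i) := boxE; rewrite !ffunE => /(congr1 val)/= tE.
have /andP[gm0 _] := g_itv m i; have /andP[gn0 _] := g_itv n i.
(* Equal truncations put both values of [g] in one half-open unit interval, so they differ by
   strictly less than 1. *)
have /andP[ml mr] := truncn_itv gm0; have /andP[nl nr] := truncn_itv gn0.
rewrite -tE -natr1 in nl nr; rewrite -natr1 in mr.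
have -> : f n i - f m i = (g n i - g m i) * e by rewrite /g; field; lra.
rewrite normrM (gtr0_norm e0) gtr_pMl// ltr_norml.
by apply/andP; split; lra.
Qed.

(** Multiplication by the unit number [expi b] preserves the modulus and turns the left side into
    the distance from [expi a] to [expi b]. *)
Lemma normr_expiB1 (R : realType) (a b : R) :
  `|expi (a - b) - 1| ^+ 2 = (cos a - cos b) ^+ 2 + (sin a - sin b) ^+ 2.
Proof.
have -> : `|expi (a - b) - 1| = `|expi a - expi b|.
  rewrite -{2}(subrK b a) (expiD (a - b)) -[X in _ = `|_ - X|]mul1r -mulrBl.
  by rewrite normRcM normr_expi mulr1.
by rewrite normRcE.
Qed.

(** This crude bound, uniform in time, serves the coordinates of large index. *)
Lemma normr_expiB1_le4 (R : realType) (x : R) : `|expi x - 1| ^+ 2 <= 4.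
Proof.
have le2 : `|expi x - 1| <= 2.
  by rewrite (le_trans (ler_normB _ _))// -expi0 !normr_expi; lra.
rewrite (_ : 4 = 2 ^+ 2); last by ring.
by rewrite lerXn2r// nnegrE.
Qed.

(** The pigeonhole is applied to the [N] cosines and [N] sines at the times [n%:R * s]; the
    difference of the two times found is a positive multiple of [s]. *)
Lemma expi_return (R : realType) (lam : nat -> R) (N : nat) (s e : R) :
  0 < s -> 0 < e ->
  exists2 t, s <= t & forall k, (k < N)%N -> `|expi (lam k * t) - 1| ^+ 2 <= e.
Proof.
move=> s0 e0.
pose f n (i : 'I_N + 'I_N) : R :=
  match i with inl k => cos (lam k * (n%:R * s))
             | inr k => sin (lam k * (n%:R * s)) end.
have [||m [n [mn close]]] := @bounded_pigeonhole R _ f (e / 4).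
- move=> n [k|k] /=; rewrite ler_norml.
    by rewrite cos_geN1 cos_le1.
  by rewrite sin_geN1 sin_le1.
- by rewrite divr_gt0.
(* One factor of the square is bounded by 2 and the other by [e / 4], so [e] need not be small. *)
have sqr_close (x y : R) : `|x| <= 1 -> `|y| <= 1 -> `|x - y| < e / 4 ->
    (x - y) ^+ 2 <= e / 2.
  move=> x1 y1 xy; have xy2 : `|x - y| <= 2.
    by rewrite (le_trans (ler_normB _ _))//; lra.
  rewrite -real_normK ?num_real// expr2.
  rewrite (_ : e / 2 = 2 * (e / 4)); last by field.
  by rewrite ler_pM// ltW.
exists ((n - m)%:R * s).
  by rewrite ler_peMl ?(ltW s0)// ler1n subn_gt0.
move=> k kN; rewrite natrB ?(ltnW mn)// mulrBl mulrBr normr_expiB1.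
have cs := close (inl (Ordinal kN)); have sn := close (inr (Ordinal kN)).
have := @sqr_close _ _ _ _ cs; have := @sqr_close _ _ _ _ sn.
rewrite /= !ler_norml !cos_geN1 !cos_le1 !sin_geN1 !sin_le1.
by move=> /(_ isT isT) ? /(_ isT isT) ?; lra.
Qed.

Lemma oscillator_flow_return (R : realType) (lam : nat -> R) (A : ell2 R) (s e : R) :
  0 < s -> 0 < e -> exists2 t, s <= t & `|oscillator_flow lam t A - A| < e.
Proof.
move=> s0 e0.
pose a : R^nat := fun k => `|A k| ^+ 2.
pose S := limn (series a).
have S0 : 0 <= S by exact: ell2_lim_ge0.
have a0 k : 0 <= a k by exact: sqr_ge0.
have e20 : 0 < e ^+ 2 by rewrite exprn_gt0.
have [N tail] : exists N, S - series a N < e ^+ 2 / 16.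
  have /cvgrPdist_lt/(_ (e ^+ 2 / 16)) := @ell2_cvg R A.
  rewrite divr_gt0// => /(_ isT)[N _ /(_ N (leqnn N))/= h].
  by exists N; apply: le_lt_trans h; exact: ler_norm.
(* Chosen so that [d * S] is at most [e ^+ 2 / 4]; the added 1 keeps the denominator positive when
   [A] is zero. *)
pose d := e ^+ 2 / (4 * (S + 1)).
have d0 : 0 < d by rewrite divr_gt0//; lra.
have [t st close] := @expi_return R lam N s d s0 d0.
exists t => //.
set B := _ - A.
have BE k : `|B k| ^+ 2 = `|expi (lam k * t) - 1| ^+ 2 * a k.
  rewrite -[B k]/(expi (lam k * t) * A k - A k) -[X in _ - X]mul1r -mulrBl.
  by rewrite normRcM exprMn.
have partial n : series (fun k => `|B k| ^+ 2) n <= d * S + 4 * (S - series a N).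
  (* Enlarging the range lets every partial sum be cut at [N]: the head is bounded through [close],
     the rest by 4 times the tail of [a]. *)
  apply: (@le_trans _ _ (series (fun k => `|B k| ^+ 2) (N + n)%N)).
    apply: nondecreasing_series (leq_addl _ _) => k _ _.
    exact: sqr_ge0.
  rewrite /series/= (@big_cat_nat _ _ _ N)//= ?leq_addr//.
  have SN m : series a m <= S by exact: ell2_lim_ge.
  apply: lerD.
    apply: (@le_trans _ _ (d * series a N)); last first.
      by rewrite ler_pM2l.
    rewrite /series/= mulr_sumr big_nat [leRHS]big_nat.
    by apply: ler_sum => k /andP[_ kN]; rewrite BE ler_wpM2r// close.
  have := SN (N + n)%N.
  rewrite {1}/series/= (@big_cat_nat _ _ _ N)//= ?leq_addr// => h.
  apply: (@le_trans _ _ (4 * \sum_(N <= k < N + n) a k)).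
    rewrite mulr_sumr; apply: ler_sum => k _.
    by rewrite BE ler_wpM2r// normr_expiB1_le4.
  by rewrite ler_pM2l// /series/=; lra.
have dS : d * S <= e ^+ 2 / 4.
  rewrite (_ : e ^+ 2 / 4 = d * (S + 1)); last by rewrite /d; field; lra.
  by rewrite ler_pM2l//; lra.
rewrite -(@ltr_pXn2r _ 2) ?nnegrE ?(ltW e0)//.
rewrite -[`|B|]/(ell2_norm B) ell2_norm_sqr.
(* Head and tail contribute at most [e ^+ 2 / 4] each. *)
apply: (@le_lt_trans _ _ (d * S + 4 * (S - series a N))); last by lra.
apply: limr_le; first exact: ell2_cvg.
by apply: nearW => n; exact: partial.
Qed.

Theorem theorem5 (R : realType) (lam : nat -> R)
    (lam_gt0 : forall k : nat, 0 < lam k) (A : ell2 R) :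
  nonwandering (oscillator_flow lam) A.
Proof.
move=> O /nbhs_normP[e /= e0 ballO] T T0.
(* The return time is only bounded below by a weak inequality; using [T + 1] makes it exceed [T]
   strictly. *)
have T10 : 0 < T + 1 by lra.
have [t Tt close] := @oscillator_flow_return R lam A _ _ T10 e0.
exists t; first by lra.
exists (oscillator_flow lam t A); split.
  by apply: ballO; rewrite /ball_/= distrC.
by exists A => //; apply: ballO; rewrite /ball_/= subrr normr0.
Qed.
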